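(* Consider a permutation gridded in the descending $(\operatorname{Av}(213),\operatorname{Av}(132))$ staircase with cells $1,2,3,\dots$, decomposed so that, for $j\ge 0$, cells $6j+1,6j+2$ form a vertical domino, cells $6j+4,6j+5$ form a horizontal domino, and cells $6j+3$ and $6j+6$ are connecting cells. Suppose that for every cell of a domino, its non-leaves lie between consecutive skew components of the adjacent connecting cell (its leaves being free). Then the gridded permutation avoids $1324$.
   Context: Staircase griddings. The points of the permutation are assigned to cells $1,2,3,\dots$ so that: odd cells avoid $213$ and even cells avoid $132$; for $k$ odd, every point of cell $k$ has larger value than every point of cell $k+1$, positions interleaving freely (cells $k,k+1$ share a column, a $(V)$ pair); for $k$ even, every point of cell $k$ precedes in position every point of cell $k+1$, values interleaving freely (cells $k,k+1$ share a row, an $(H)$ pair); and if $j\ge i+2$, every point of cell $i$ is both earlier in position and larger in value than every point of cell $j$. Dominoes. A vertical domino is a $(V)$ pair of cells (upper cell avoiding $213$, lower avoiding $132$) whose union avoids $1324$; a horizontal domino is an $(H)$ pair of cells (left cell avoiding $132$, right cell avoiding $213$) whose union avoids $1324$. Leaves. The leaves of a cell avoiding $213$ are its right-to-left maxima; the leaves of a cell avoiding $132$ are its left-to-right minima (both computed within the cell). Other points are non-leaves. Every permutation is uniquely a skew sum of skew indecomposables, its skew components. For a domino cell and the connecting cell whose index differs from its own by one (if there is one; cell $1$ has none), ''lies between consecutive skew components'' is read on the axis along which the two cells interleave: in value if they form an $(H)$ pair (cells of vertical dominoes), in position if they form a $(V)$ pair (cells of horizontal dominoes). It means that no skew component of the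 connecting cell has points both before and after the given point along that axis; the two exterior positions, before all components and after all components, are allowed. *)

(* Defs.v *)
From HB Require Import structures.
From mathcomp Require Import all_boot all_fingroup.

Set Implicit Arguments.
Unset Strict Implicit.
Unset Printing Implicit Defensive.

(* A permutation of size n is s : 'S_n, whose points are (i, s i); a point is
   named by its position i : 'I_n, and a set of points by a set of positions. *)

(* The points of A contain the pattern w, given in one-line notation. *)
Definition contains n (s : 'S_n) (A : {set 'I_n}) (w : seq nat) : Prop :=
  exists f : 'I_(size w) -> 'I_n,
    [/\ forall i, f i \in A,
        forall i j : 'I_(size w), i < j -> f i < f j
      & forall i j : 'I_(size w), (s (f i) < s (f j)) = (nth 0 w i < nth 0 w j)].

Definition avoids n (s : 'S_n) (A : {set 'I_n}) (w : seq nat) : Prop :=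
  ~ contains s A w.

Definition precedes n (A B : {set 'I_n}) : bool :=
  [forall a in A, forall b in B, a < b].

Definition above n (s : 'S_n) (A B : {set 'I_n}) : bool :=
  [forall a in A, forall b in B, s b < s a].

Definition skew_lt n (s : 'S_n) (A B : {set 'I_n}) : bool :=
  precedes A B && above s A B.

Definition skew_indecomposable n (s : 'S_n) (A : {set 'I_n}) : bool :=
  (A != set0) &&
  [forall B : {set 'I_n}, forall C : {set 'I_n},
     [&& B != set0, C != set0 & B :|: C == A] ==> ~~ skew_lt s B C].

Definition skew_decomposition n (s : 'S_n) (A : {set 'I_n})
    (Cs : seq {set 'I_n}) : bool :=
  [&& \bigcup_(C <- Cs) C == A,
      pairwise (skew_lt s) Cs
    & all (skew_indecomposable s) Cs].

Definition skew_component n (s : 'S_n) (A C : {set 'I_n}) : Prop :=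
  exists2 Cs, skew_decomposition s A Cs & C \in Cs.

(* A gridding is the map c sending each point to the index of its cell. *)
Definition cell n (c : 'I_n -> nat) (k : nat) : {set 'I_n} :=
  [set i | c i == k].

Definition V_pair n (s : 'S_n) (A B : {set 'I_n}) : bool := above s A B.
Definition H_pair n (A B : {set 'I_n}) : bool := precedes A B.

Definition staircase_gridding n (s : 'S_n) (c : 'I_n -> nat) : Prop :=
  [/\ forall i, 0 < c i,
      forall k, avoids s (cell c k) (if odd k then [:: 2; 1; 3]
                                     else [:: 1; 3; 2]),
      forall k, odd k -> V_pair s (cell c k) (cell c k.+1),
      forall k, 0 < k -> ~~ odd k -> H_pair (cell c k) (cell c k.+1)
    & forall i j, 0 < i -> i + 2 <= j -> skew_lt s (cell c i) (cell c j)].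

Definition vertical_domino n (s : 'S_n) (A B : {set 'I_n}) : Prop :=
  [/\ V_pair s A B, avoids s A [:: 2; 1; 3], avoids s B [:: 1; 3; 2]
    & avoids s (A :|: B) [:: 1; 3; 2; 4]].

Definition horizontal_domino n (s : 'S_n) (A B : {set 'I_n}) : Prop :=
  [/\ H_pair A B, avoids s A [:: 1; 3; 2], avoids s B [:: 2; 1; 3]
    & avoids s (A :|: B) [:: 1; 3; 2; 4]].

Definition domino_decomposition n (s : 'S_n) (c : 'I_n -> nat) : Prop :=
  forall j,
    vertical_domino s (cell c (6 * j + 1)) (cell c (6 * j + 2)) /\
    horizontal_domino s (cell c (6 * j + 4)) (cell c (6 * j + 5)).

Definition domino_cell (k : nat) : Prop :=
  exists j, k \in [:: 6 * j + 1; 6 * j + 2; 6 * j + 4; 6 * j + 5].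

Definition connecting_cell (k : nat) : Prop :=
  exists j, k \in [:: 6 * j + 3; 6 * j + 6].

Definition rl_max n (s : 'S_n) (A : {set 'I_n}) (i : 'I_n) : bool :=
  (i \in A) && [forall j : 'I_n in A, (i < j) ==> (s j < s i)].

Definition lr_min n (s : 'S_n) (A : {set 'I_n}) (i : 'I_n) : bool :=
  (i \in A) && [forall j in A, (j < i) ==> (s i < s j)].

(* Odd cells are the 213-avoiding ones, even cells the 132-avoiding ones. *)
Definition leaf n (s : 'S_n) (c : 'I_n -> nat) (i : 'I_n) : bool :=
  if odd (c i) then rl_max s (cell c (c i)) i else lr_min s (cell c (c i)) i.

(* The axis on which the adjacent cells d and e interleave: position when they
   form a (V) pair (the smaller index is odd), value when they form an (H)
   pair. *)
Definition axis n (s : 'S_n) (d e : nat) (i : 'I_n) : nat :=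
  if odd (minn d e) then i else s i.

Definition between_skew_components n (s : 'S_n) (A : {set 'I_n})
    (x : 'I_n -> nat) (i : 'I_n) : Prop :=
  forall C, skew_component s A C ->
    ~ exists a b, [/\ a \in C, b \in C, x a < x i & x i < x b].

Definition non_leaves_between n (s : 'S_n) (c : 'I_n -> nat) : Prop :=
  forall d e, domino_cell d -> connecting_cell e -> d = e.+1 \/ e = d.+1 ->
  forall i, i \in cell c d -> ~~ leaf s c i ->
    between_skew_components s (cell c e) (axis s d e) i.

(* Main.v *)
Require Import Defs.
From mathcomp Require Import all_boot all_fingroup.
From mathcomp Require Import zify.

Set Implicit Arguments.
Unset Strict Implicit.
Unset Printing Implicit Defensive.

(** In the staircase, an ascent (one point below and to the left of another)
    lies either inside one cell or goes from an even cell to an adjacent odd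
    one. Let p1, p2, p3, p4 be the points of a 1324, from left to right.
    Applying this to the ascents p1p4, p1p2, p1p3, p2p4, p3p4 puts the whole
    copy in the cells of p1 and p4, and the avoidance of 132 and 213 by the
    cells forces these to differ and to contain exactly one of p2, p3 each. The
    two cells are not a domino, so one of them is connecting and holds two of
    the points; they form an ascent, hence lie in one skew component. The
    domino cell holds the other two, so whichever of p2, p3 lies there is a
    non-leaf, and it falls strictly inside that component on the shared axis. *)

Lemma precedesP n (A B : {set 'I_n}) :
  reflect {in A & B, forall x y : 'I_n, x < y} (precedes A B).
Proof.
apply: (iffP 'forall_implyP) => ltAB x => [y xA|xA].
  by have /'forall_implyP := ltAB x xA; apply.
by apply/'forall_implyP => y; apply: ltAB.
Qed.

Lemma aboveP n (s : 'S_n) (A B : {set 'I_n}) :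
  reflect {in A & B, forall x y : 'I_n, s y < s x} (above s A B).
Proof.
apply: (iffP 'forall_implyP) => gtAB x => [y xA|xA].
  by have /'forall_implyP := gtAB x xA; apply.
by apply/'forall_implyP => y; apply: gtAB.
Qed.

Lemma skew_ltS n (s : 'S_n) (A B A' B' : {set 'I_n}) :
  A' \subset A -> B' \subset B -> skew_lt s A B -> skew_lt s A' B'.
Proof.
move=> /subsetP sA /subsetP sB /andP[/precedesP ltAB /aboveP gtAB].
apply/andP; split; first by apply/precedesP => x y /sA xA /sB; apply: ltAB.
by apply/aboveP => x y /sA xA /sB; apply: gtAB.
Qed.

(** Strong induction on [#|A|]: a decomposable set splits into two nonempty, hence smaller, parts
    whose decompositions concatenate. Without existence, a statement about all skew components could
    be vacuous. *)
Lemma skew_decomposition_exists n (s : 'S_n) (A : {set 'I_n}) :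
  exists Cs, skew_decomposition s A Cs.
Proof.
have [m] := ubnP #|A|; elim: m A => // m IHm A leAm.
have [->|A_neq0] := eqVneq A set0.
  by exists [::]; rewrite /skew_decomposition big_nil eqxx.
have [indA|] := boolP (skew_indecomposable s A).
  by exists [:: A]; rewrite /skew_decomposition big_seq1 eqxx /= indA.
rewrite /skew_indecomposable A_neq0 => /forallPn[B /forallPn[C]].
rewrite negb_imply negbK => /andP[/and3P[B_neq0 C_neq0 /eqP defA] ltBC].
have dBC : [disjoint B & C].
  apply/pred0P => x /=; apply/negP => /andP[xB xC].
  by case/andP: ltBC => /precedesP/(_ x x xB xC); rewrite ltnn.
have cardA : #|A| = #|B| + #|C|.
  by rewrite -defA cardsU disjoint_setI0 // cards0 subn0.
rewrite -!card_gt0 in B_neq0 C_neq0.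
have [|Bs /and3P[/eqP defB ltBs indBs]] := IHm B; first by lia.
have [|Ds /and3P[/eqP defC ltDs indDs]] := IHm C; first by lia.
exists (Bs ++ Ds).
rewrite /skew_decomposition big_cat /= defB defC defA eqxx /=.
rewrite pairwise_cat ltBs ltDs all_cat indBs indDs !andbT.
(* Components from different lists are ordered because they lie inside [B] and [C] respectively. *)
apply/allrelP => D E DBs EDs; apply: skew_ltS ltBC.
  by rewrite -defB (big_rem D) //= subsetUl.
by rewrite -defC (big_rem E) //= subsetUl.
Qed.

(** Points in different components of a skew decomposition form a descent, so an ascent cannot be
    split. *)
Lemma skew_component_ascent n (s : 'S_n) (A : {set 'I_n}) (x y : 'I_n) :
    x \in A -> y \in A -> x < y -> s x < s y ->
  exists2 C, skew_component s A C & x \in C /\ y \in C.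
Proof.
move=> xA yA ltxy ltsxy.
have [Cs decA] := skew_decomposition_exists s A.
have /and3P[/eqP defA /(pairwiseP set0) ltCs _] := decA.
have nthC z : z \in A -> exists2 i, i < size Cs & z \in nth set0 Cs i.
  rewrite -defA big_tnth => /bigcupP[i _].
  by rewrite (tnth_nth set0); exists i.
have [[i ltiCs xi] [j ltjCs yj]] := (nthC x xA, nthC y yA).
case: (ltngtP i j) => [ltij|ltji|eqij].
- have /andP[_ /aboveP/(_ x y xi yj)] := ltCs i j ltiCs ltjCs ltij.
  by rewrite ltnNge ltnW.
- have /andP[/precedesP/(_ y x yj xi)] := ltCs j i ltjCs ltiCs ltji.
  by rewrite ltnNge ltnW.
exists (nth set0 Cs i); last by rewrite {2}eqij.
by exists Cs; rewrite ?mem_nth.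
Qed.

Lemma not_between_ascent n (s : 'S_n) (A : {set 'I_n}) (f : 'I_n -> nat)
    (i x y : 'I_n) :
    x \in A -> y \in A -> x < y -> s x < s y -> f x < f i -> f i < f y ->
  ~ between_skew_components s A f i.
Proof.
move=> xA yA ltxy ltsxy ltxi ltiy betw.
have [C compC [xC yC]] := skew_component_ascent xA yA ltxy ltsxy.
by case: (betw C compC); exists x, y.
Qed.

Lemma odd_ascent_non_leaf n (s : 'S_n) (c : 'I_n -> nat) (x y : 'I_n) :
  odd (c x) -> c y = c x -> x < y -> s x < s y -> ~~ leaf s c x.
Proof.
move=> oddx eqc ltxy ltsxy; rewrite /leaf oddx negb_and.
apply/orP; right; apply/forallPn; exists y.
by rewrite !negb_imply inE eqc eqxx ltxy -leqNgt ltnW.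
Qed.

Lemma even_ascent_non_leaf n (s : 'S_n) (c : 'I_n -> nat) (x y : 'I_n) :
  ~~ odd (c y) -> c x = c y -> x < y -> s x < s y -> ~~ leaf s c y.
Proof.
move=> /negPf evy eqc ltxy ltsxy; rewrite /leaf evy negb_and.
apply/orP; right; apply/forallPn; exists x.
by rewrite !negb_imply inE eqc eqxx ltxy -leqNgt ltnW.
Qed.

(** Cells at distance two or more only form descents. In a (V) pair an ascent must climb from the
    lower, even cell; in an (H) pair it must start in the left cell, again the even one. *)
Lemma ascent_cells n (s : 'S_n) (c : 'I_n -> nat) (x y : 'I_n) :
    staircase_gridding s c -> x < y -> s x < s y ->
  c x = c y \/
  [/\ ~~ odd (c x), odd (c y) & c y = (c x).+1 \/ c x = (c y).+1].
Proof.
case=> c_gt0 _ gtV ltH ltfar ltxy ltsxy.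
have cellE z k : c z = k -> z \in cell c k by move=> <-; rewrite inE.
have [eqc|neqc] := eqVneq (c x) (c y); [by left | right].
have [farxy|nfarxy] := leqP (c x + 2) (c y).
  have /andP[_ /aboveP/(_ x y)] := ltfar _ _ (c_gt0 x) farxy.
  by rewrite !inE !eqxx => /(_ isT isT); lia.
have [faryx|nfaryx] := leqP (c y + 2) (c x).
  have /andP[/precedesP/(_ y x) + _] := ltfar _ _ (c_gt0 y) faryx.
  by rewrite !inE !eqxx => /(_ isT isT); lia.
have [eqcy|eqcx] : c y = (c x).+1 \/ c x = (c y).+1 by lia.
  have [oddx|evx] := boolP (odd (c x)).
    have /aboveP/(_ x y (cellE _ _ erefl) (cellE _ _ eqcy)) := gtV _ oddx.
    by lia.
  by rewrite eqcy /= evx; split=> //; left.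
have [oddy|evy] := boolP (odd (c y)).
  by rewrite eqcx /= oddy; split=> //; right.
have /precedesP/(_ y x (cellE _ _ erefl) (cellE _ _ eqcx)) :=
  ltH _ (c_gt0 y) evy.
by lia.
Qed.

Lemma adjacent_cells k : 0 < k ->
  [\/ exists j, k = 6 * j + 1 \/ k = 6 * j + 4,
      domino_cell k /\ connecting_cell k.+1
    | connecting_cell k /\ domino_cell k.+1].
Proof.
(* Blocks of six cells start at residue 1, hence the predecessor. *)
move=> k_gt0; pose j := k.-1 %/ 6.
have /orP[|/orP[|]] : [|| (k == 6 * j + 1) || (k == 6 * j + 4),
    (k == 6 * j + 2) || (k == 6 * j + 5)
  | (k == 6 * j + 3) || (k == 6 * j + 6)] by rewrite /j; lia.
- by move=> k14; constructor 1; exists j; lia.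
- by move=> k25; constructor 2; split; exists j; rewrite !inE; lia.
(* After cell [6 * j + 6] comes the first cell of the next block, whence the witness [j.+1]. *)
move=> /orP[k3|k6]; constructor 3; split;
  by [exists j; rewrite !inE; lia | exists j.+1; rewrite !inE; lia].
Qed.

Theorem corollary3p3 (n : nat) (s : 'S_n) (c : 'I_n -> nat)
  (hgrid : staircase_gridding s c)
  (hdom : domino_decomposition s c)
  (hnonleaf : non_leaves_between s c) :
  avoids s [set: 'I_n] [:: 1; 3; 2; 4].
Proof.
move=> [f [_ ltf sf]].
have [c_gt0 avoid_cell gtV ltH _] := hgrid.
pose p1 := f (@Ordinal 4 0 isT); pose p2 := f (@Ordinal 4 1 isT).
pose p3 := f (@Ordinal 4 2 isT); pose p4 := f (@Ordinal 4 3 isT).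
have lt12 : p1 < p2 by apply: ltf.
have lt23 : p2 < p3 by apply: ltf.
have lt34 : p3 < p4 by apply: ltf.
have lts13 : s p1 < s p3 by rewrite sf.
have lts32 : s p3 < s p2 by rewrite sf.
have lts24 : s p2 < s p4 by rewrite sf.
have in_p (P : pred 'I_n) : P p1 -> P p2 -> P p3 -> P p4 -> forall i, P (f i).
  move=> P1 P2 P3 P4 [[|[|[|[|//]]]] lti];
    by rewrite (bool_irrelevance lti isT).
have no132 : ~~ odd (c p1) -> c p2 = c p1 -> c p3 = c p1 -> False.
  move=> /negPf ev1 c2 c3; have := avoid_cell (c p1); rewrite ev1; apply.
  exists (fun i => f (widen_ord (leqnSn 3) i)); split.
  - by move=> [[|[|[|//]]] lti]; rewrite inE; apply/eqP;
      [rewrite -[RHS]/(c p1) | rewrite -c2 | rewrite -c3];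
      congr (c (f _)); apply: val_inj.
  - by move=> i j ltij; apply: ltf.
  - by move=> [[|[|[|//]]] lti] [[|[|[|//]]] ltj]; rewrite sf.
(* Dropping [p1] by the index shift [lift ord0] leaves 324, which is order isomorphic to 213. *)
have no213 : odd (c p4) -> c p2 = c p4 -> c p3 = c p4 -> False.
  move=> od4 c2 c3; have := avoid_cell (c p4); rewrite od4; apply.
  exists (fun i => f (lift ord0 i)); split.
  - by move=> [[|[|[|//]]] lti]; rewrite inE; apply/eqP;
      [rewrite -c2 | rewrite -c3 | rewrite -[RHS]/(c p4)];
      congr (c (f _)); apply: val_inj.
  - by move=> i j ltij; apply: ltf.
  - by move=> [[|[|[|//]]] lti] [[|[|[|//]]] ltj]; rewrite sf.
have no1324 A B :
  avoids s (A :|: B) [:: 1; 3; 2; 4] ->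
  ~ [/\ p1 \in A :|: B, p2 \in A :|: B, p3 \in A :|: B & p4 \in A :|: B].
  by move=> avAB [? ? ? ?]; apply: avAB; exists f; split=> //; apply: in_p.
have cell_axis d e i x y : domino_cell d -> connecting_cell e ->
    d = e.+1 \/ e = d.+1 -> c i = d -> ~~ leaf s c i -> c x = e -> c y = e ->
    x < y -> s x < s y -> axis s d e x < axis s d e i ->
    axis s d e i < axis s d e y -> False.
  move=> dd ce de ci nli cx cy ltxy ltsxy ltxi ltiy.
  have incell z k : c z = k -> z \in cell c k by move=> <-; rewrite inE.
  apply: (not_between_ascent (incell _ _ cx) (incell _ _ cy) ltxy ltsxy ltxi).
    exact: ltiy.
  by apply: hnonleaf; rewrite ?incell.
have asc := @ascent_cells n s c _ _ hgrid.
(* If [q] were in neither end cell, the ascent from [p1] would make its cell odd and the ascent to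
   [p4] would make it even. *)
have cell_mid (q : 'I_n) : p1 < q -> s p1 < s q -> q < p4 -> s q < s p4 ->
    c q = c p1 \/ c q = c p4.
  move=> lt1 lts1 lt4 lts4.
  have [->|[_ odq _]] := asc p1 q lt1 lts1; first by left.
  have [->|[evq _ _]] := asc q p4 lt4 lts4; first by right.
  by rewrite odq in evq.
have lt13 := ltn_trans lt12 lt23; have lt24 := ltn_trans lt23 lt34.
have lts12 := ltn_trans lts13 lts32; have lts34 := ltn_trans lts32 lts24.
have c2 := cell_mid p2 lt12 lts12 lt24 lts24.
have c3 := cell_mid p3 lt13 lts13 lt34 lts34.
have c_gt1 := c_gt0 p1; have c_gt4 := c_gt0 p4.
have [c14|[ev1 od4 adj]] :=
  asc p1 p4 (ltn_trans lt12 lt24) (ltn_trans lts12 lts24).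
  by have [od|ev] := boolP (odd (c p1));
    [apply: no213 | apply: no132] => //; lia.
have {}no132 : ~ (c p2 = c p1 /\ c p3 = c p1) by case; apply: no132.
have {}no213 : ~ (c p2 = c p4 /\ c p3 = c p4) by case; apply: no213.
have nodom k : k = c p1 /\ c p4 = k.+1 \/ k = c p4 /\ c p1 = k.+1 ->
    ~ exists j, k = 6 * j + 1 \/ k = 6 * j + 4.
  move=> ck [j kE]; have [[_ _ _ dV] [_ _ _ dH]] := hdom j.
  by case: kE => kE; [apply: (no1324 _ _ dV) | apply: (no1324 _ _ dH)];
    rewrite !inE; split; lia.
have incell q k : c q = k -> q \in cell c k by move=> <-; rewrite inE.
case: adj => [c4|c1].
  (* An (H) pair with the cell of [p1] on the left: the opposite placement would put [p3] before
     [p2]. *)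
  have [c21 c34] : c p2 = c p1 /\ c p3 = c p4.
    have /precedesP/(_ p3 p2) := ltH (c p1) c_gt1 ev1.
    case: c2 c3 => [c21|c24] [c31|c34];
      [by case: no132 | by [] | | by case: no213].
    by rewrite -c4 => /(_ (incell _ _ c31) (incell _ _ c24)); lia.
  have axisE d e q : minn d e = c p1 -> axis s d e q = s q.
    by rewrite /axis => ->; rewrite (negPf ev1).
  have nl2 := even_ascent_non_leaf (c := c) (x := p1) (y := p2).
  have nl3 := odd_ascent_non_leaf (c := c) (x := p3) (y := p4).
  case: (adjacent_cells c_gt1) => [|[d1 e4]|[e1 d4]]; first by apply: nodom; left.
    (* In value, [p2] lies between [p3] and [p4], and [p3] between [p1] and [p2]; each case uses one
       of these. *)
    apply: (cell_axis _ _ p2 p3 p4 d1 e4) => //; rewrite ?axisE ?c34 //; try lia.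
    by apply: nl2; rewrite ?c21.
  apply: (cell_axis _ _ p3 p1 p2 d4 e1) => //; rewrite ?axisE ?c34 //; try lia.
  by apply: nl3; rewrite ?c34.
(* A (V) pair with the cell of [p4] on top: the opposite placement would put [p3] above [p2]. The
   shared axis is now position, where 1324 is already in order. *)
have [c24 c31] : c p2 = c p4 /\ c p3 = c p1.
  have /aboveP/(_ p3 p2) := gtV (c p4) od4.
  case: c2 c3 => [c21|c24] [c31|c34]; [by case: no132 | | by [] | by case: no213].
  by rewrite -c1 => /(_ (incell _ _ c34) (incell _ _ c21)); lia.
have axisE d e q : minn d e = c p4 -> axis s d e q = q.
  by rewrite /axis => ->; rewrite od4.
have nl2 := odd_ascent_non_leaf (c := c) (x := p2) (y := p4).
have nl3 := even_ascent_non_leaf (c := c) (x := p1) (y := p3).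
case: (adjacent_cells c_gt4) => [|[d4 e1]|[e4 d1]]; first by apply: nodom; right.
  apply: (cell_axis _ _ p2 p1 p3 d4 e1) => //; rewrite ?axisE //; try lia.
  by apply: nl2; rewrite ?c24.
apply: (cell_axis _ _ p3 p2 p4 d1 e4) => //; rewrite ?axisE //; try lia.
by apply: nl3; rewrite ?c31.
Qed.
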